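(* Let $G$ be a connected graph of order $n$, minimum degree $\delta\geq 3$ and maximum degree $\Delta$ that does not contain $C_4$ as a subgraph. Define $\varepsilon_\Delta=\Delta\delta-2\lfloor \Delta/2\rfloor+1$, $\varepsilon_\delta=\delta^2-2\lfloor\delta/2\rfloor+1$, and $N=n-\varepsilon_\Delta+\varepsilon_\delta$. Then \[ \mu(G)\leq \frac{5}{3}\cdot\frac{N(N-1)}{n(n-1)}\cdot\frac{n+2\varepsilon_\Delta}{\varepsilon_\delta}+8 . \]
   Context: For a connected graph $G$ of order $n\ge2$, $W(G)=\sum_{\{u,v\}\subseteq V(G)} d_G(u,v)$ is the Wiener index (sum of shortest-path distances over unordered pairs of distinct vertices) and $\mu(G)=\binom{n}{2}^{-1}W(G)$ is the average distance. $C_4$ is the cycle on four vertices; ''not containing $C_4$ as a subgraph'' refers to any (not necessarily induced) subgraph. *)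

(* Defs.v *)
From mathcomp Require Import all_boot all_order all_algebra.
Set Implicit Arguments. Unset Strict Implicit. Unset Printing Implicit Defensive.
Import Order.TTheory GRing.Theory Num.Theory.

Section Graph.
Variables (T : finType) (e : rel T).

Definition simple_graph := symmetric e /\ irreflexive e.

Definition connected_graph := forall x y : T, connect e x y.

Definition deg (x : T) : nat := #|[set y | e x y]|.

Definition ball (x : T) (k : nat) : {set T} :=
  iter k (fun S : {set T} => S :|: [set y | [exists z in S, e z y]]) [set x].

Definition gdist (x y : T) : nat := find (fun k => y \in ball x k) (iota 0 #|T|.+1).

Definition wiener : nat := (\sum_(x : T) \sum_(y : T) gdist x y) %/ 2.

Definition avg_dist : rat := (wiener%:R / ('C(#|T|, 2))%:R)%R.

Definition has_C4 : Prop :=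
  exists a b c d : T, [/\ uniq [:: a; b; c; d], e a b, e b c, e c d & e d a].

Definition min_degree (d : nat) : Prop :=
  (exists v, deg v = d) /\ forall v, d <= deg v.
Definition max_degree (D : nat) : Prop :=
  (exists v, deg v = D) /\ forall v, deg v <= D.

End Graph.

(* Main.v *)
(* Pick centres pairwise at distance at least 5, starting from a vertex of maximum
   degree and adding each time a vertex at distance exactly 5 from the previous ones,
   and send every vertex to a nearest centre, at distance at most 4.  This changes
   each distance by at most 8, and the fibre of a centre contains its ball of radius 2,
   which has at least epsd (for the first centre, epsD) points as there is no C4.
   It remains to bound the Wiener index of the weighted set of centres, whose
   distances are dominated by those of equally spaced points on a line. *)

Require Import Defs.
From mathcomp Require Import all_boot all_order all_algebra.
From mathcomp Require Import zify ring lra.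
Set Implicit Arguments. Unset Strict Implicit. Unset Printing Implicit Defensive.
Import Order.TTheory GRing.Theory Num.Theory.
Local Open Scope ring_scope.

(** * Balls and the graph distance *)

Section Distance.
Local Open Scope nat_scope.
Context (T : finType) (e : rel T).

Lemma ball0 x : ball e x 0 = [set x].
Proof. by []. Qed.

Lemma ballSP x k y :
  reflect (y \in ball e x k \/ exists2 z, z \in ball e x k & e z y)
          (y \in ball e x k.+1).
Proof.
rewrite inE; apply: (iffP orP) => -[]; [by left| |by left|].
- by rewrite inE => /exists_inP[z zB ezy]; right; exists z.
- by case=> z zB ezy; right; rewrite inE; apply/exists_inP; exists z.
Qed.

Lemma ball_center x k : x \in ball e x k.
Proof. by elim: k => [|k IH]; [rewrite ball0 inE | apply/ballSP; left]. Qed.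

Lemma ball_trans x y z j k :
  y \in ball e x j -> z \in ball e y k -> z \in ball e x (j + k).
Proof.
move=> yx; elim: k z => [|k IH] z; first by rewrite ball0 inE addn0 => /eqP->.
rewrite addnS => /ballSP[/IH zB|[w /IH wB ewz]]; apply/ballSP; first by left.
by right; exists w.
Qed.

Lemma ball_edge x y : e x y -> y \in ball e x 1.
Proof. by move=> exy; apply/ballSP; right; exists x => //; exact: ball_center. Qed.

Lemma sub_ball x j k : j <= k -> {subset ball e x j <= ball e x k}.
Proof.
by move=> /subnKC <- y yB; apply: ball_trans yB _; exact: ball_center.
Qed.

Lemma ball_path x p : path e x p -> last x p \in ball e x (size p).
Proof.
elim: p x => [|y p IH] x; first by rewrite inE.
by case/andP=> /ball_edge exy /IH; exact: (@ball_trans _ _ _ 1).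
Qed.

Hypotheses (symE : symmetric e) (conE : connected_graph e).

Lemma ball_sym x y k : (y \in ball e x k) = (x \in ball e y k).
Proof.
suff H : forall u v, v \in ball e u k -> u \in ball e v k by apply/idP/idP; exact: H.
elim: k => [|k IH] u v; first by rewrite !ball0 !inE eq_sym.
case/ballSP => [/IH vB|[w /IH wB ewv]]; first by apply/ballSP; left.
by rewrite -add1n; apply: ball_trans wB; apply: ball_edge; rewrite symE.
Qed.

(** A path made duplicate-free has fewer than [#|T|] edges. Hence the search defining [gdist] always
    succeeds and its default value is never returned. *)
Lemma ball_full x y : y \in ball e x #|T|.
Proof.
case/connectP: (conE x y) => p /shortenP[q pq uq _ ->].
apply: sub_ball (ball_path pq).
by have := max_card (mem (x :: q)); rewrite (card_uniqP uq) /=; exact: ltnW.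
Qed.

Lemma gdist_leP x y k : (gdist e x y <= k) = (y \in ball e x k).
Proof.
pose B j := y \in ball e x j.
have hasB : has B (iota 0 #|T|.+1).
  by apply/hasP; exists #|T|; [rewrite mem_iota ltnS leqnn | exact: ball_full].
have ltd : gdist e x y < #|T|.+1 by move: hasB; rewrite has_find size_iota.
have Bd : y \in ball e x (gdist e x y).
  by have := nth_find 0 hasB; rewrite nth_iota // add0n.
apply/idP/idP => [le_dk|yB]; first exact: sub_ball Bd.
rewrite leqNgt; apply/negP => lt_kd; have := before_find 0 lt_kd.
by rewrite nth_iota ?add0n; [rewrite yB | exact: ltn_trans ltd].
Qed.

Lemma gdist_refl x : gdist e x x = 0.
Proof. by apply/eqP; rewrite -leqn0 gdist_leP ball_center. Qed.

Lemma gdist_sym x y : gdist e x y = gdist e y x.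
Proof.
by apply/eqP; rewrite eqn_leq !gdist_leP ball_sym -gdist_leP leqnn ball_sym -gdist_leP leqnn.
Qed.

Lemma gdist_triangle y x z : gdist e x z <= gdist e x y + gdist e y z.
Proof. by rewrite gdist_leP (@ball_trans x y) // -gdist_leP. Qed.

Lemma gdist_edge x y : e x y -> gdist e x y <= 1.
Proof. by rewrite gdist_leP => /ball_edge. Qed.

Lemma gdist_pred x y : 0 < gdist e x y ->
  exists2 z, gdist e x z < gdist e x y & e z y.
Proof.
case E: (gdist e x y) => [//|k] _.
have: y \in ball e x k.+1 by rewrite -gdist_leP E.
case/ballSP=> [|[z zB ezy]]; first by rewrite -gdist_leP E ltnn.
by exists z => //; rewrite ltnS gdist_leP.
Qed.

(** Going through [f x] and [f y] costs at most [2 * r] per ordered pair; the diagonal costs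
    nothing, whence the factor [#|T|.-1]. *)
Lemma sum_gdist_le (f : T -> T) r :
  (forall x, gdist e x (f x) <= r) ->
  \sum_x \sum_y gdist e x y <=
    2 * r * (#|T| * #|T|.-1) + \sum_x \sum_y gdist e (f x) (f y).
Proof.
move=> fr.
have -> : 2 * r * (#|T| * #|T|.-1) = \sum_(x : T) \sum_(y : T) 2 * r * (y != x).
  transitivity (\sum_(x : T) 2 * r * #|T|.-1).
    by rewrite sum_nat_const mulnCA.
  apply: eq_bigr => x _; rewrite -big_distrr /=; congr (_ * _).
  rewrite -(cardC1 x) -sum1_card big_mkcond /=.
  by apply: eq_bigr => y _; rewrite !inE; case: (y != x).
rewrite -big_split; apply: leq_sum => x _; rewrite -big_split; apply: leq_sum => y _ /=.
have [->|_] := eqVneq y x; first by rewrite gdist_refl.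
have := gdist_triangle (f x) x y; have := gdist_triangle (f y) (f x) y.
have := fr x; have := fr y; rewrite [gdist e y _]gdist_sym; lia.
Qed.

End Distance.

(** * Size of balls of radius two without four-cycles *)

Section SecondNeighbourhood.
Local Open Scope nat_scope.
Context (T : finType) (e : rel T).
Hypotheses (symE : symmetric e) (irrE : irreflexive e).

(** Handshake lemma in the subgraph induced by [A]: ordering vertices by [enum_rank] splits each
    degree into later and earlier neighbours, and both kinds have the same total. *)
Lemma even_sum_deg (A : {set T}) :
  ~~ odd (\sum_(x in A) #|[set y in A | e x y]|).
Proof.
pose below x y := (enum_rank x < enum_rank y) && e x y.
have -> : \sum_(x in A) #|[set y in A | e x y]| =
    \sum_(x in A) \sum_(y in A) (below x y + below y x).
  apply: eq_bigr => x _; rewrite -sum1_card [RHS]big_mkcond [LHS]big_mkcond /=.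
  apply: eq_bigr => y _; rewrite inE /below [e y x]symE; case: (y \in A) => //=.
  case: ltngtP => [||/ord_inj/enum_rank_inj->]; rewrite ?irrE //; by case: (e x y).
under eq_bigr => x _ do rewrite big_split.
by rewrite big_split /= [X in _ + X]exchange_big addnn odd_double.
Qed.

(** Two distinct common neighbours [u], [v] would close the cycle [x u y v]. *)
Lemma card_common_neighbours x y : ~ has_C4 e -> x != y ->
  #|[set z | e x z & e y z]| <= 1.
Proof.
move=> noC4 neq_xy; apply/card_le1_eqP => u v; rewrite !inE.
move=> /andP[exu eyu] /andP[exv eyv]; apply/eqP/negPn/negP => neq_uv; apply: noC4.
exists x, u, y, v; split; rewrite // 1?[e u y]symE 1?[e v x]symE //=.
have ne a b : e a b -> a != b by apply: contraTneq => ->; rewrite irrE.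
by rewrite !inE !negb_or neq_xy [u == v]eq_sym neq_uv [u == y]eq_sym !ne.
Qed.

(* Count the walks of length two starting at [v]: they end at [v], in its
   neighbourhood (where they come in an even number, each end point being hit at
   most once), or in the rest of the ball (each point being hit at most once). *)
Lemma card_ball2 v delta : ~ has_C4 e -> (forall x, delta <= deg e x) ->
  deg e v * delta < #|ball e v 2| + (deg e v)./2.*2.
Proof.
move=> noC4 le_delta; set A := [set y | e v y]; set d := deg e v.
pose codeg y := #|[set z | e v z & e y z]|.
have vA : v \notin A by rewrite inE irrE.
have walks : \sum_(z in A) deg e z = \sum_y codeg y.
  transitivity (\sum_(z in A) \sum_y e z y).
    apply: eq_bigr => z _; rewrite /deg -sum1_card big_mkcond /=.
    by apply: eq_bigr => y _; rewrite inE; case: (e z y).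
  rewrite exchange_big; apply: eq_bigr => y _; rewrite /codeg -sum1_card.
  rewrite big_mkcond [RHS]big_mkcond; apply: eq_bigr => z _.
  by rewrite !inE [e y z]symE; case: (e v z); case: (e z y).
have inner : \sum_(y in A) codeg y <= d./2.*2.
  have := even_sum_deg A.
  have -> : \sum_(x in A) #|[set y in A | e x y]| = \sum_(y in A) codeg y.
    by apply: eq_bigr => y _; apply: eq_card => z; rewrite !inE.
  suff : \sum_(y in A) codeg y <= d by lia.
  rewrite /d /deg -sum1_card; apply: leq_sum => y yA.
  by apply: card_common_neighbours => //; apply: contraNneq vA => ->.
have outer : \sum_(y | y \notin v |: A) codeg y <= #|ball e v 2 :\: (v |: A)|.
  rewrite -sum1_card big_mkcond [leqRHS]big_mkcond; apply: leq_sum => y _.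
  rewrite in_setD; case: ifP => // yN /=; case: ifP => yB; rewrite /=.
    apply: card_common_neighbours => //.
    by apply: contraNneq yN => ->; rewrite setU11.
  rewrite leqn0 cards_eq0; apply/eqP/setP => z; rewrite !inE.
  apply/negP => /andP[evz eyz]; move/negP: yB; apply.
  by rewrite (@ball_trans _ _ _ z _ 1 1) // ball_edge // symE.
have AB : v |: A \subset ball e v 2.
  apply/subsetP => y /setU1P[->|]; first exact: ball_center.
  by rewrite inE => /ball_edge; exact: sub_ball.
have total : \sum_y codeg y =
    d + \sum_(y in A) codeg y + \sum_(y | y \notin v |: A) codeg y.
  rewrite (bigID (mem (v |: A))) /= (big_setU1 _ vA) /=; congr (_ + _ + _).
  by apply: eq_card => z; rewrite !inE andbb.
have le_walks : d * delta <= \sum_(z in A) deg e z.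
  by rewrite -sum_nat_const; apply: leq_sum.
(* Removing [v |: A], of size [d + 1], from the ball offsets the [d] walks that return to [v]; the
   remaining 1 makes the inequality strict. *)
have := cardsD (ball e v 2) (v |: A); rewrite (setIidPr AB).
have := subset_leq_card AB; rewrite cardsU1 vA -/(deg e v) -/d.
lia.
Qed.

End SecondNeighbourhood.

(** * Greedy choice of the centres *)

Section ScatteredSets.
Local Open Scope nat_scope.
Context (T : finType) (e : rel T).
Hypotheses (symE : symmetric e) (conE : connected_graph e).

(* Sets of points at mutual distance at least 5 whose distances are bounded
   above by those of the points 0, 5, ..., 5(|A| - 1) on a line. *)
Definition scattered (A : {set T}) : Prop :=
  [/\ forall a b, a \in A -> b \in A -> a != b -> 5 <= gdist e a b,
      forall a b, a \in A -> b \in A -> gdist e a b + 5 <= 5 * #|A|,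
      forall a, a \in A -> 2 * (\sum_(b in A) gdist e a b) + 5 * #|A| <= 5 * #|A| ^ 2
    & 3 * (\sum_(a in A) \sum_(b in A) gdist e a b) + 5 * #|A| <= 5 * #|A| ^ 3].

Lemma scattered1 v : scattered [set v].
Proof.
split; rewrite ?cards1.
- by move=> a b /set1P-> /set1P->; rewrite eqxx.
- by move=> a b /set1P-> /set1P->; rewrite gdist_refl.
- by move=> a /set1P->; rewrite big_set1 gdist_refl.
- by rewrite !big_set1 gdist_refl.
Qed.

(** Through [a0], the new point behaves like a new end of the line: its distances sum to at most
    [5(1 + ... + m)] with [m = #|A|], and adding twice this sum turns [5(m^3 - m)/3] into the same
    expression at [m + 1]. *)
Lemma scatteredU1 (A : {set T}) x a0 : scattered A ->
  (forall a, a \in A -> 5 <= gdist e a x) -> a0 \in A -> gdist e a0 x <= 5 ->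
  scattered (x |: A).
Proof.
move=> [packA diamA rowA totA] farx a0A nearx.
have xA : x \notin A by apply/negP => /farx; rewrite gdist_refl.
have m_gt0 : 0 < #|A| by rewrite card_gt0; apply/set0Pn; exists a0.
have diamx a : a \in A -> gdist e a x <= 5 * #|A|.
  by move=> aA; have := diamA a a0 aA a0A; have := gdist_triangle conE a0 a x; lia.
have rowx : 2 * (\sum_(b in A) gdist e x b) <= 5 * #|A| ^ 2 + 5 * #|A|.
  have : \sum_(b in A) gdist e x b <= \sum_(b in A) (5 + gdist e a0 b).
    apply: leq_sum => b _; have := gdist_triangle conE a0 x b.
    by rewrite [gdist e x a0]gdist_sym //; lia.
  by rewrite big_split sum_nat_const /=; have := rowA _ a0A; lia.
have sumx : \sum_(a in A) gdist e a x = \sum_(b in A) gdist e x b.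
  by apply: eq_bigr => a _; exact: gdist_sym.
split; rewrite ?cardsU1 ?xA /=.
- move=> a b /setU1P[->|aA] /setU1P[->|bA]; rewrite ?eqxx // => neq.
  + by rewrite gdist_sym // farx.
  + exact: farx.
  + exact: packA.
- move=> a b /setU1P[->|aA] /setU1P[->|bA].
  + by rewrite gdist_refl //; lia.
  + by have := diamx b bA; rewrite gdist_sym //; lia.
  + by have := diamx a aA; lia.
  + by have := diamA a b aA bA; lia.
- move=> a /setU1P[->|aA]; rewrite big_setU1 //=.
  + by rewrite gdist_refl //; lia.
  + by have := rowA a aA; have := diamx a aA; lia.
- have -> : \sum_(a in x |: A) \sum_(b in x |: A) gdist e a b =
      2 * (\sum_(b in A) gdist e x b) + \sum_(a in A) \sum_(b in A) gdist e a b.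
    rewrite big_setU1 //= big_setU1 //= gdist_refl //.
    under [in X in _ + X = _]eq_bigr => a _ do rewrite big_setU1 //=.
    by rewrite big_split /= sumx; lia.
  lia.
Qed.

Lemma scattered_cover v : exists A : {set T}, [/\ v \in A, scattered A &
  forall x, exists2 a, a \in A & gdist e a x <= 4].
Proof.
(* Enlarge the set until it covers; at [k = #|T|.+1] the second alternative is impossible. *)
suff H k : exists A : {set T}, [/\ v \in A, scattered A &
    (forall x, exists2 a, a \in A & gdist e a x <= 4) \/ k <= #|A|].
  case: (H #|T|.+1) => A [vA sA [cov|]]; first by exists A.
  by rewrite ltnNge max_card.
elim: k => [|k [A [vA sA [cov|leA]]]].
- by exists [set v]; split; [rewrite inE | exact: scattered1 | right].
- by exists A; split => //; left.
pose far x := [forall (a | a \in A), 4 < gdist e a x].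
have [far0|] := pickP far; last first.
  move=> nofar; exists A; split=> //; left => x; have := nofar x.
  by move/negbT/forall_inPn => [a aA]; rewrite -leqNgt; exists a.
(* Take the far vertex [x] closest to [v]. Its predecessor [z] on a shortest path from [v] is not
   far, so some centre is within 4 of [z], hence within 5 of [x]. *)
move=> farx0; case: (arg_minnP (gdist e v) farx0) => x farx minx.
have gt0 : 0 < gdist e v x by have /forall_inP/(_ v vA) := farx; exact: leq_trans.
have [z ltz ezx] := gdist_pred conE gt0.
have /forall_inPn[a aA] : ~~ far z by apply: contraL ltz => /minx; rewrite -leqNgt.
rewrite -leqNgt => az; have /forall_inP xA := farx.
have ax : gdist e a x <= 5.
  by have := gdist_triangle conE z a x; have := gdist_edge conE ezx; lia.
exists (x |: A); split; first by rewrite setU1r.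
- exact: scatteredU1 ax.
- right; rewrite cardsU1; suff -> : x \notin A by [].
  by apply/negP => /xA; rewrite gdist_refl.
Qed.

End ScatteredSets.

(** * Reduction to a weighted distance sum over the centres *)

Section NearestCentre.
Local Open Scope nat_scope.

(* Since [d v v = 0], the pair [(v, v)] does not contribute to the product of the
   excesses: this is what makes the heavy vertex [v] count only linearly. *)
Lemma weighted_sum_le (T : finType) (A : {set T}) (d : T -> T -> nat)
    (s : T -> nat) (k Q R : nat) (v : T) :
  (forall a b, a \in A -> b \in A -> d a b = d b a) -> v \in A -> d v v = 0 ->
  (forall a b, a \in A -> b \in A -> d a b <= R) ->
  (forall a, a \in A -> 2 * (\sum_(b in A) d a b) <= Q) ->
  \sum_(a in A) \sum_(b in A) (k + s a) * (k + s b) * d a b + R * s v ^ 2 <=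
   k ^ 2 * (\sum_(a in A) \sum_(b in A) d a b) +
   k * Q * (\sum_(a in A) s a) + R * (\sum_(a in A) s a) ^ 2.
Proof.
move=> dC vA dvv dR dQ; set S := \sum_(a in A) s a.
(* Expand the product of weights; symmetry of [d] merges the two mixed sums. *)
have -> : \sum_(a in A) \sum_(b in A) (k + s a) * (k + s b) * d a b =
    k ^ 2 * (\sum_(a in A) \sum_(b in A) d a b) +
    k * (\sum_(a in A) s a * (2 * (\sum_(b in A) d a b))) +
    \sum_(a in A) \sum_(b in A) s a * s b * d a b.
  have -> : k * (\sum_(a in A) s a * (2 * \sum_(b in A) d a b)) =
      \sum_(a in A) \sum_(b in A) k * s a * d a b +
      \sum_(a in A) \sum_(b in A) k * s b * d a b.
    rewrite [X in _ = _ + X]exchange_big -big_split big_distrr /=.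
    apply: eq_bigr => a aA; rewrite -big_split mulnA mulnA big_distrr /=.
    by apply: eq_bigr => b bA /=; rewrite [d b a]dC //; ring.
  rewrite big_distrr -!big_split; apply: eq_bigr => a _ /=.
  rewrite big_distrr -!big_split; apply: eq_bigr => b _ /=; ring.
have cross : \sum_(a in A) s a * (2 * (\sum_(b in A) d a b)) <= Q * S.
  rewrite /S big_distrr; apply: leq_sum => a aA /=.
  by rewrite [leqRHS]mulnC leq_mul2l dQ ?orbT.
suff excess : \sum_(a in A) \sum_(b in A) s a * s b * d a b + R * s v ^ 2 <= R * S ^ 2.
  by have := leq_mul (leqnn k) cross; rewrite mulnA; lia.
have -> : R * S ^ 2 = \sum_(a in A) \sum_(b in A) R * (s a * s b).
  rewrite -mulnn /S big_distrlr big_distrr; apply: eq_bigr => a _ /=.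
  by rewrite big_distrr.
have le a b : a \in A -> b \in A -> s a * s b * d a b <= R * (s a * s b).
  by move=> aA bA; rewrite mulnC leq_mul2r dR ?orbT.
(* Isolate row [v], then its entry [(v, v)]: it is [R * s v ^ 2] on the right, matching the extra
   term on the left, and 0 in the sum on the left. *)
rewrite (big_setD1 v vA) [leqRHS](big_setD1 v vA) /=.
rewrite (big_setD1 v vA) [X in _ <= X + _](big_setD1 v vA) /= dvv muln0 add0n -mulnn.
have row : \sum_(b in A :\ v) s v * s b * d v b <= \sum_(b in A :\ v) R * (s v * s b).
  by apply: leq_sum => b /setD1P[_ bA]; exact: le.
suff : \sum_(a in A :\ v) \sum_(b in A) s a * s b * d a b <=
       \sum_(a in A :\ v) \sum_(b in A) R * (s a * s b) by lia.
apply: leq_sum => a /setD1P[_ aA]; apply: leq_sum => b bA; exact: le.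
Qed.

Context (T : finType) (e : rel T).
Hypotheses (symE : symmetric e) (conE : connected_graph e).

Lemma sum_gdist_fibres (A : {set T}) (f : T -> T) : (forall x, f x \in A) ->
  \sum_x \sum_y gdist e (f x) (f y) =
  \sum_(a in A) \sum_(b in A)
    #|[set x | f x == a]| * #|[set x | f x == b]| * gdist e a b.
Proof.
move=> fA; rewrite (partition_big f (mem A)) //=; apply: eq_bigr => a _.
transitivity (\sum_(x | f x == a) \sum_(b in A) #|[set y | f y == b]| * gdist e a b).
  apply: eq_bigr => x /eqP->; rewrite (partition_big f (mem A)) //=.
  apply: eq_bigr => b _; rewrite -sum_nat_const.
  by apply: eq_big => [y|y /eqP->]; rewrite ?inE.
rewrite sum_nat_const cardsE big_distrr /=.
by apply: eq_bigr => b _; rewrite mulnA.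
Qed.

(** If [x] is within 2 of [a], a different nearest centre would also be within 2 of [x], hence
    within 4 of [a], against the separation 5. *)
Lemma nearest_centre (A : {set T}) v : v \in A -> scattered e A ->
  (forall x, exists2 a, a \in A & gdist e a x <= 4) ->
  exists f : T -> T, [/\ forall x, f x \in A, forall x, gdist e x (f x) <= 4
    & forall a, a \in A -> ball e a 2 \subset [set x | f x == a]].
Proof.
move=> vA [packA _ _ _] cov; exists (fun x => [arg min_(a < v in A) gdist e a x]).
split=> [x|x|a aA]; first by case: arg_minnP.
- case: arg_minnP => // b bA minb; have [a aA ax] := cov x.
  by rewrite gdist_sym //; exact: leq_trans (minb a aA) ax.
- apply/subsetP => x; rewrite -gdist_leP // inE => ax.
  case: arg_minnP => // b bA /(_ a aA) minb; apply/negPn/negP => neq_ba.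
  have := packA b a bA aA neq_ba; have := gdist_triangle conE x b a.
  by rewrite [gdist e x a]gdist_sym //; lia.
Qed.

End NearestCentre.

(** * The polynomial inequality and the conclusion *)

(** Here [m] counts the centres, [k] is [epsd], [p] is [epsD - epsd], and [p + q] is the total
    excess of the fibre sizes over [k]. *)
Lemma weight_polynomial_le (R : realFieldType) (m k p q N : R) :
  1 <= m -> 1 <= k -> 0 <= p -> 0 <= q -> N = m * k + q ->
  k * (k ^+ 2 * (m ^+ 3 - m) + 3 * k * (m ^+ 2 - m) * (p + q) +
       3 * (m - 1) * ((p + q) ^+ 2 - p ^+ 2)) <=
  N * (N - 1) * (N + 3 * p + 2 * k).
Proof.
move=> m1 k1 p0 q0 NE; rewrite -subr_ge0.
(* The gap is rewritten as a sum of products whose factors are all nonnegative. *)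
have -> : N * (N - 1) * (N + 3 * p + 2 * k) -
    k * (k ^+ 2 * (m ^+ 3 - m) + 3 * k * (m ^+ 2 - m) * (p + q) +
         3 * (m - 1) * ((p + q) ^+ 2 - p ^+ 2)) =
    q ^+ 3 + 4 * (q ^+ 2 * k) + k ^+ 2 * q * (5 * m - 2) + k ^+ 3 * (m * (m - 1)) +
    3 * p * (q ^+ 2 + q * k) + N * (k - 1) * (N + 3 * p + 2 * k).
  by rewrite NE; ring.
have m0 : 0 <= m by lra.
have k0 : 0 <= k by lra.
have mk0 : 0 <= m * k by rewrite mulr_ge0.
have N0 : 0 <= N by rewrite NE addr_ge0.
have q20 : 0 <= q ^+ 2 by rewrite exprn_ge0.
have qk0 : 0 <= q * k by rewrite mulr_ge0.
by rewrite !addr_ge0 ?mulr_ge0 ?exprn_ge0 //; lra.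
Qed.

Theorem theorem6p2 (T : finType) (e : rel T) (delta Delta : nat) :
  simple_graph e -> connected_graph e -> (2 <= #|T|)%N ->
  min_degree e delta -> (3 <= delta)%N -> max_degree e Delta ->
  ~ has_C4 e ->
  let n : rat := (#|T|)%:R in
  let epsD : rat := (Delta * delta)%:R - 2 * (Delta./2)%:R + 1 in
  let epsd : rat := (delta * delta)%:R - 2 * (delta./2)%:R + 1 in
  let N : rat := n - epsD + epsd in
  avg_dist e <= (5 / 3) * ((N * (N - 1)) / (n * (n - 1))) * ((n + 2 * epsD) / epsd) + 8.
Proof.
move=> [symE irrE] conE n_ge2 [[v1 degv1] degmin] delta_ge3 [[v degv] degmax] noC4.
cbv zeta; set n : rat := #|T|%:R; set epsD : rat := _ + 1.
set epsd : rat := (delta * delta)%:R - _ + 1; set N := n - epsD + epsd.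
(* Integer form of [epsD] and [epsd], for any degree; [epsE] checks that the truncated subtraction
   is exact. *)
pose eps d := ((d * delta).+1 - d./2.*2)%N.
have eps_ball a : (eps (deg e a) <= #|ball e a 2|)%N.
  by have := card_ball2 symE irrE a noC4 degmin; rewrite /eps; lia.
(* One more unit of degree adds [delta >= 3] to the product and at most 2 to [d./2.*2]. So every
   fibre has at least [k] points. *)
have eps_homo d1 d2 : (d1 <= d2)%N -> (eps d1 <= eps d2)%N.
  move=> le12; have : (d1 * delta + (d2 - d1) * 2 <= d2 * delta)%N by nia.
  by rewrite /eps; lia.
have epsE d : (eps d)%:R = (d * delta)%:R - 2 * (d./2)%:R + 1 :> rat.
  have le : (d./2.*2 <= (d * delta).+1)%N by nia.
  by rewrite /eps natrB // -muln2 natrM -natr1; ring.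
have [A [vA sA cov]] := scattered_cover symE conE v.
have [f [fA f4 fball]] := nearest_centre symE conE vA sA cov.
pose k := eps delta; pose K := eps Delta; pose c a := #|[set x | f x == a]|; pose s a := (c a - k)%N.
have k_gt0 : (0 < k)%N by rewrite /k /eps; nia.
have kE : k%:R = epsd by rewrite /k epsE.
have KE : K%:R = epsD by rewrite /K epsE.
have kK : (k <= K)%N by apply: eps_homo; rewrite -degv1.
have c_ge a : a \in A -> (eps (deg e a) <= c a)%N.
  by move=> aA; apply: leq_trans (eps_ball a) (subset_leq_card (fball a aA)).
have cE a : a \in A -> c a = (k + s a)%N.
  move=> aA; rewrite subnKC //; apply: leq_trans (c_ge a aA).
  by apply: eps_homo.
(* The centre [v] has degree [Delta], so its fibre has at least [K] points. *)
have sv : (K - k <= s v)%N by rewrite leq_sub2r // /K -degv c_ge.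
have total : (#|T| = #|A| * k + \sum_(a in A) s a)%N.
  rewrite -sum_nat_const -big_split /= -sum1_card (partition_big f (mem A)) //=.
  by apply: eq_bigr => a aA; rewrite -cE // sum1_card /c cardsE.
have m_gt0 : (0 < #|A|)%N by rewrite card_gt0; apply/set0Pn; exists v.
have [_ diamA rowA totA] := sA.
pose W := (\sum_x \sum_y gdist e (f x) (f y))%N.
have WE : W = (\sum_(a in A) \sum_(b in A) (k + s a) * (k + s b) * gdist e a b)%N.
  rewrite /W (sum_gdist_fibres e fA).
  by apply: eq_bigr => a aA; apply: eq_bigr => b bA; rewrite -!cE.
set S := (\sum_(a in A) s a)%N in total.
have sS : (s v <= S)%N by rewrite /S (bigD1 v) //= leq_addr.
clearbody s K k.
have row a : a \in A -> (2 * \sum_(b in A) gdist e a b <= 5 * (#|A| ^ 2 - #|A|))%N.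
  by move=> /rowA; lia.
have diam a b : a \in A -> b \in A -> (gdist e a b <= 5 * (#|A| - 1))%N.
  by move=> aA bA; have := diamA a b aA bA; lia.
(* With [m = #|A|], apply [weighted_sum_le] for [Q = 5(m^2 - m)] and [R = 5(m - 1)], and replace
   [s v] by its lower bound [epsD - epsd]. *)
have leW : 3 * W%:R <=
    5 * (epsd ^+ 2 * (#|A|%:R ^+ 3 - #|A|%:R) +
         3 * epsd * (#|A|%:R ^+ 2 - #|A|%:R) * S%:R +
         3 * (#|A|%:R - 1) * (S%:R ^+ 2 - (epsD - epsd) ^+ 2)).
  have := weighted_sum_le s k (fun a b _ _ => gdist_sym symE conE a b) vA
    (gdist_refl conE v) diam row.
  have := sv; rewrite -leq_sqr => /(leq_mul (leqnn (5 * (#|A| - 1)))).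
  have := leq_mul (leqnn (k ^ 2)) totA; rewrite -WE -/S.
  have le_m2 : (#|A| <= #|A| ^ 2)%N by nia.
  rewrite -!(ler_nat rat) !(natrD, natrM, natrX, natrB) // kE KE.
  lra.
have n_ge2r : 2 <= n by rewrite ler_nat.
have k_ge1 : 1 <= epsd by rewrite -kE ler1n.
have p_ge0 : 0 <= epsD - epsd by rewrite -kE -KE subr_ge0 ler_nat.
have q_ge0 : 0 <= S%:R - (epsD - epsd).
  by rewrite -kE -KE -natrB // subr_ge0 ler_nat (leq_trans sv).
have NE : N = #|A|%:R * epsd + (S%:R - (epsD - epsd)).
  by rewrite /N /n total natrD natrM kE; ring.
have m_ge1 : 1 <= #|A|%:R :> rat by rewrite ler1n.
have := weight_polynomial_le m_ge1 k_ge1 p_ge0 q_ge0 NE.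
rewrite [_ + (S%:R - _)]addrC subrK => poly.
(* Multiplied by [epsd], the right side of [leW] is five times the left side of [poly], whose last
   factor is [n + 2 * epsD]. *)
have leWN : W%:R <= 5 / 3 * (N * (N - 1) * ((n + 2 * epsD) / epsd)).
  rewrite !mulrA ler_pdivlMr; last by lra.
  have : N + 3 * (epsD - epsd) + 2 * epsd = n + 2 * epsD by rewrite /N; ring.
  move=> NnE; rewrite NnE in poly.
  have := ler_wpM2l (_ : 0 <= epsd) leW; move/(_ ltac:(lra)); lra.
(* Moving both ends by at most 4 gives the 8; the truncated halving in [wiener] can only lower it,
   which suits an upper bound. *)
have wienerE : 2 * (wiener e)%:R <= 8 * (n * (n - 1)) + W%:R.
  have le : (2 * wiener e <= 8 * (#|T| * #|T|.-1) + W)%N.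
    apply: leq_trans (sum_gdist_le symE conE f4).
    by rewrite /wiener mulnC leq_trunc_div.
  move: le; rewrite -(ler_nat rat) natrD !natrM -subn1 natrB ?(ltnW n_ge2) //.
have binE : ('C(#|T|, 2))%:R = n * (n - 1) / 2.
  have /(congr1 (fun i => i%:R : rat)) : ('C(#|T|, 2) * 2 = #|T| * (#|T| - 1))%N.
    by rewrite bin2 subn1 muln2 even_halfK //; case: #|T| => // i; rewrite oddM andNb.
  rewrite !natrM natrB ?(ltnW n_ge2) // -/n; lra.
have nn_gt0 : 0 < n * (n - 1) by rewrite mulr_gt0 //; lra.
have n_neq0 : n != 0 by rewrite gt_eqF //; lra.
have n1_neq0 : n - 1 != 0 by rewrite gt_eqF //; lra.
have k_neq0 : epsd != 0 by rewrite gt_eqF //; lra.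
rewrite /avg_dist binE.
have -> : (wiener e)%:R / (n * (n - 1) / 2) = 2 * (wiener e)%:R / (n * (n - 1)).
  by field; rewrite n_neq0 n1_neq0.
rewrite ler_pdivrMr //.
have -> : (5 / 3 * (N * (N - 1) / (n * (n - 1))) * ((n + 2 * epsD) / epsd) + 8) *
    (n * (n - 1)) =
    5 / 3 * (N * (N - 1) * ((n + 2 * epsD) / epsd)) + 8 * (n * (n - 1)).
  by field; rewrite n_neq0 n1_neq0 k_neq0.
lra.
Qed.
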